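(* For every integer $n\ge0$, the set of plane-oriented increasing trees of size $n+1$ is in bijection with the set of path diagrams of length $n$ built on the infinite family of step vectors $a_\ell=(1,\ell)$ ($\ell\in\mathbb{N}=\{1,2,\dots\}$), $b=(1,-1)$, $c=(1,0)$, with possibility function $\mathrm{pos}(a_{j,\ell})=j+1$ for all $\ell\in\mathbb{N}$, $\mathrm{pos}(b_j)=j+1$, $\mathrm{pos}(c_j)=j+1$, for all $j\ge0$.
   Context: A plane-oriented increasing tree of size $m$ is a rooted plane (ordered) tree on the nodes $\{1,\dots,m\}$, with arbitrary outdegrees and children ordered left to right, whose labels increase along every path from the root. A word $u=u_1\cdots u_n$ over $\{a_\ell:\ell\in\mathbb{N}\}\cup\{b,c\}$ determines points $M_0=(0,0)$, $M_j=M_{j-1}+u_j$; only paths whose points all have nonnegative $y$-coordinate and with $M_n$ at height $0$ are considered. With $y_j$ the height of $M_j$, the labelled path $\lambda(u)=v_1\cdots v_n$ has $v_j=a_{y_{j-1},\ell}$ if $u_j=a_\ell$, $v_j=b_{y_{j-1}}$ if $u_j=b$, $v_j=c_{y_{j-1}}$ if $u_j=c$. A path diagram of length $n$ is a pair $(\lambda(u),s)$ with $s=s_1\cdots s_n$ integers satisfying $0\le s_j<\mathrm{pos}(v_j)$. *)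

(* Defs.v *)
From HB Require Import structures.
From mathcomp Require Import all_boot all_order all_algebra.
From mathcomp Require Import boolp classical_sets functions.

Set Implicit Arguments.
Unset Strict Implicit.
Unset Printing Implicit Defensive.

Import Order.TTheory GRing.Theory Num.Theory.

Local Open Scope ring_scope.
Local Open Scope classical_set_scope.

(** The children of a node are ordered from left to right. *)
Inductive ltree : Type := Node of nat & seq ltree.

Fixpoint labels (t : ltree) : seq nat :=
  let: Node x ts := t in x :: flatten (map labels ts).

(** Label sequences of the paths from the root to each node of the tree. *)
Fixpoint root_paths (t : ltree) : seq (seq nat) :=
  let: Node x ts := t in
  [:: x] :: [seq x :: p | p <- flatten (map root_paths ts)].

Definition increasing (t : ltree) : bool := all (sorted ltn) (root_paths t).

(** The nodes of a tree of size [m] are identified with their labels, so every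
    element of {1, ..., m} must occur exactly once. *)
Definition plane_increasing_trees (m : nat) : set ltree :=
  [set t | perm_eq (labels t) (iota 1 m) && increasing t].

Definition posnat : Type := {l : nat | (0 < l)%N}.

Inductive letter : Type := LA of posnat | LB | LC.

Definition step (x : letter) : int * int :=
  match x with
  | LA l => (1, (val l)%:Z)
  | LB => (1, -1)
  | LC => (1, 0)
  end.

(** The point reached from the origin (0, 0) after the first [j] steps. *)
Definition point (u : seq letter) (j : nat) : int * int :=
  \sum_(x <- take j u) step x.

Definition height (u : seq letter) (j : nat) : int := (point u j).2.

Definition admissible (u : seq letter) : Prop :=
  (forall j : nat, (j <= size u)%N -> 0 <= height u j) /\
  height u (size u) = 0.

(** The integer index is the height at which the step starts; on admissible words it is always nonnegative. *)
Inductive lletter : Type := VA of int & posnat | VB of int | VC of int.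

Definition label (y : int) (x : letter) : lletter :=
  match x with
  | LA l => VA y l
  | LB => VB y
  | LC => VC y
  end.

(** With 0-based positions, the letter at position [j] starts at [point u j]. *)
Definition labelled_path (u : seq letter) : seq lletter :=
  mkseq (fun j => label (height u j) (nth LC u j)) (size u).

(** [all2] also forces [d.1] and [d.2] to have the same length. *)
Definition path_diagrams (pos : lletter -> int) (n : nat) :
    set (seq lletter * seq int) :=
  [set d | exists u : seq letter,
     [/\ size u = n, admissible u, d.1 = labelled_path u &
         all2 (fun v s => 0 <= s < pos v) d.1 d.2]].

Definition port_pos (v : lletter) : int :=
  match v with
  | VA j l => j + 1
  | VB j => j + 1
  | VC j => j + 1
  end.

(* Main.v *)
(** Read the labels of a tree in increasing order, keeping a row of open slots,
    initially a single one: a label fills slot number [s] and replaces it by as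
    many slots as it has children.  The outdegrees minus one are the steps of a
    path whose height is the number of open slots minus one, and [s] is the
    possibility.  The largest label always fills the last slot without opening
    any, so it carries no information.  Backwards, the labels that are still to
    be placed form an increasing forest with one tree per open slot. *)
Require Import Defs.
From mathcomp Require Import all_boot all_order all_algebra.
From mathcomp Require Import boolp classical_sets functions.
From mathcomp Require Import zify.

Set Implicit Arguments.
Unset Strict Implicit.
Unset Printing Implicit Defensive.

Import GRing.Theory.

(** * Labels of increasing trees and forests *)

Definition root_label (t : ltree) : nat := let: Node x _ := t in x.

Definition forest_labels (F : seq ltree) : seq nat := flatten (map labels F).

Lemma forest_labels_cat (F G : seq ltree) :
  forest_labels (F ++ G) = forest_labels F ++ forest_labels G.
Proof. by rewrite /forest_labels map_cat flatten_cat. Qed.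

Lemma root_in_labels (t : ltree) : root_label t \in labels t.
Proof. by case: t => x ts; rewrite inE eqxx. Qed.

Lemma root_in_forest_labels (F : seq ltree) :
  {subset map root_label F <= forest_labels F}.
Proof.
elim: F => //= t F IH y; rewrite inE /forest_labels /= mem_cat.
by case/orP=> [/eqP->|/IH ->]; rewrite ?root_in_labels ?orbT.
Qed.

(** Every root path of a child starts with the child's root label, so prefixing [x] only adds one
    comparison, with that label. *)
Lemma increasing_Node (x : nat) (ts : seq ltree) :
  increasing (Node x ts) = all (fun t => (x < root_label t) && increasing t) ts.
Proof.
rewrite /increasing /=; elim: ts => //= t ts IH.
rewrite map_cat all_cat {}IH; congr andb.
rewrite all_map; case: t => y us; rewrite /= !all_map /= andbT.
by case: ltnP => //= xy; apply: eq_all => p /=; rewrite xy.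
Qed.

Lemma root_min (t : ltree) : increasing t -> all (leq (root_label t)) (labels t).
Proof.
(* The children are nested in a list, so the hypothesis on trees is used inside an induction on
   [ts]. *)
move: t; fix IH 1; case=> x ts; rewrite increasing_Node /= leqnn /=.
elim: ts => //= t ts IHts /andP[/andP[xt /IH t_min] /IHts ts_min].
rewrite all_cat ts_min andbT.
by apply: sub_all t_min => y; apply/leq_trans/ltnW.
Qed.

(** A root is the minimum of its own tree, so the minimum of the forest can only sit at a root. *)
Lemma min_label_is_root (x : nat) (F : seq ltree) :
  all increasing F -> x \in forest_labels F -> all (leq x) (forest_labels F) ->
  exists F1 ts F2, F = F1 ++ Node x ts :: F2.
Proof.
elim: F => //= t F IH /andP[t_inc F_inc].
rewrite /forest_labels /= mem_cat all_cat => + /andP[t_ge F_ge].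
case/orP=> [xt|xF].
  have := allP (root_min t_inc) x xt; have := allP t_ge _ (root_in_labels t).
  case: t {t_inc t_ge xt} => y ts /= xy yx.
  by exists [::], ts, F; rewrite (@anti_leq x y) ?xy.
have [F1 [ts [F2 ->]]] := IH F_inc xF F_ge.
by exists (t :: F1), ts, F2.
Qed.

Definition increasing_forest (x m : nat) (F : seq ltree) : bool :=
  perm_eq (forest_labels F) (iota x m) && all increasing F.

(** The new root [x] lies below all other labels, so grafting any consecutive trees [ts] under it,
    or undoing this, keeps the forest increasing. *)
Lemma increasing_forest_graft (x m : nat) (F1 ts F2 : seq ltree) :
  increasing_forest x m.+1 (F1 ++ Node x ts :: F2) =
  increasing_forest x.+1 m (F1 ++ ts ++ F2).
Proof.
rewrite /increasing_forest.
have /permPl-> : perm_eq (forest_labels (F1 ++ Node x ts :: F2))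
    (x :: forest_labels (F1 ++ ts ++ F2)).
  rewrite !forest_labels_cat /forest_labels /= -/(forest_labels _).
  by rewrite -cat1s perm_catCA.
rewrite /= perm_cons.
case: (boolP (perm_eq _ _)) => //= lab.
rewrite !all_cat /= increasing_Node all_predI.
suff : all (ltn x) (map root_label ts) by rewrite all_map => ->.
apply/allP => y /root_in_forest_labels yts.
have : y \in iota x.+1 m.
  by rewrite -(perm_mem lab) !forest_labels_cat !mem_cat yts orbT.
by rewrite mem_iota => /andP[].
Qed.

(** * Codes by steps and slot numbers, and their decoding *)

Definition outdegree (x : letter) : nat :=
  match x with LA l => (val l).+1 | LB => 0 | LC => 1 end.

(** Positivity of [l] separates [LA l] from [LC]. *)
Lemma outdegree_inj : injective outdegree.
Proof.
case=> [l| |] [l'| |] //=.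
- by move=> [] /val_inj ->.
- by case: l => [[]].
- by case: l' => [[]].
Qed.

Lemma outdegree_surj (c : nat) : exists x, outdegree x = c.
Proof.
case: c => [|[|c]]; first by exists LB.
  by exists LC.
by exists (LA (exist _ c.+1 (ltn0Sn c))).
Qed.

Lemma step2E (x : letter) : ((step x).2 = (outdegree x)%:Z - 1)%R.
Proof. by case: x => [l| |] //=; lia. Qed.

(** [k] is the number of open slots. *)
Fixpoint valid (k : nat) (w : seq (letter * nat)) : bool :=
  if w is (x, s) :: w' then (s < k) && valid (k.-1 + outdegree x) w'
  else k == 1.

(** Built from the end of the code: [decode x.+1 w'] fills the slots open after [x] is placed, and
    those opened by [x] start at position [s]. The empty code leaves one slot, for the largest label
    as a leaf. *)
Fixpoint decode (x : nat) (w : seq (letter * nat)) : seq ltree :=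
  if w is (l, s) :: w' then
    let F := decode x.+1 w' in
    take s F ++
      Node x (take (outdegree l) (drop s F)) :: drop (outdegree l) (drop s F)
  else [:: Node x [::]].

Lemma size_decode (k x : nat) (w : seq (letter * nat)) :
  valid k w -> size (decode x w) = k.
Proof.
elim: w k x => [|[l s] w IH] k x /=; first by move/eqP->.
case/andP=> sk /(IH _ x.+1); set F := decode _ _ => sF.
rewrite size_cat /= size_takel ?size_drop; lia.
Qed.

Lemma decode_consE (k x s : nat) (l : letter) (w : seq (letter * nat)) :
  valid k ((l, s) :: w) ->
  exists F1 ts F2, [/\ decode x ((l, s) :: w) = F1 ++ Node x ts :: F2,
    decode x.+1 w = F1 ++ ts ++ F2, size F1 = s & size ts = outdegree l].
Proof.
move=> /= /andP[sk /(size_decode x.+1)]; set F := decode _ _ => sF.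
exists (take s F), (take (outdegree l) (drop s F)),
  (drop (outdegree l) (drop s F)).
(* As [s < k], at least [s + outdegree l] trees are available and neither [take] falls short. *)
rewrite !cat_take_drop !size_takel ?size_drop //; lia.
Qed.

Lemma decode_forest (k x : nat) (w : seq (letter * nat)) :
  valid k w -> increasing_forest x (size w).+1 (decode x w).
Proof.
elim: w k x => [|[l s] w IH] k x; first by rewrite /increasing_forest /= perm_refl.
move=> w_ok; have [F1 [ts [F2 [-> Fw _ _]]]] := decode_consE x w_ok.
rewrite increasing_forest_graft -Fw.
by move: w_ok => /= /andP[_ /IH].
Qed.

Lemma graft_inj (x : nat) (F1 F1' ts ts' F2 F2' : seq ltree) :
  x \notin map root_label F1 -> x \notin map root_label F1' ->
  F1 ++ Node x ts :: F2 = F1' ++ Node x ts' :: F2' ->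
  [/\ F1 = F1', ts = ts' & F2 = F2'].
Proof.
elim: F1 F1' => [|t F1 IH] [|t' F1'] //=.
- by move=> _ _ [-> ->].
- by move=> _ + [t'E _]; rewrite -t'E inE eqxx.
- by move=> + _ [tE _]; rewrite tE inE eqxx.
rewrite !inE !negb_or => /andP[_ xF1] /andP[_ xF1'] [-> eqF].
by have [-> -> ->] := IH _ xF1 xF1' eqF.
Qed.

(** The root labelled [x] is found unambiguously in the forest; the number of trees before it gives
    the slot, its number of children the letter. *)
Lemma decode_inj (k x : nat) (w w' : seq (letter * nat)) :
  valid k w -> valid k w' -> size w = size w' -> decode x w = decode x w' ->
  w = w'.
Proof.
elim: w w' k x => [|[l s] w IH] [|[l' s'] w'] k x // w_ok w'_ok [size_ww'].
have [F1 [ts [F2 [-> Fw sF1 sts]]]] := decode_consE x w_ok.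
have [F1' [ts' [F2' [-> Fw' sF1' sts']]]] := decode_consE x w'_ok.
move: w_ok w'_ok => /= /andP[_ w_ok] /andP[_ w'_ok].
(* The remaining labels start at [x.+1]. *)
have x_fresh k' v G1 G2 : valid k' v -> decode x.+1 v = G1 ++ G2 ->
    x \notin map root_label G1.
  move=> /(@decode_forest _ x.+1) /andP[lab _] vE.
  apply/negP => /root_in_forest_labels xG1.
  have : x \in iota x.+1 (size v).+1.
    by rewrite -(perm_mem lab) vE forest_labels_cat mem_cat xG1.
  by rewrite mem_iota ltnn.
case/(graft_inj (x_fresh _ _ _ _ w_ok Fw) (x_fresh _ _ _ _ w'_ok Fw')).
move=> F1E tsE F2E; subst F1' ts' F2'.
have ll' : l = l' by apply: outdegree_inj; rewrite -sts.
subst l'; rewrite -sF1 -sF1'.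
by rewrite (IH _ _ _ w_ok w'_ok size_ww' (etrans Fw (esym Fw'))).
Qed.

(** Deleting the root [x] and releasing its children leaves a forest with one label less, to which
    induction applies. *)
Lemma decode_surj (x m : nat) (F : seq ltree) :
  increasing_forest x m.+1 F ->
  exists w, [/\ size w = m, valid (size F) w & decode x w = F].
Proof.
elim: m x F => [|m IH] x F F_inc; move: (F_inc) => /andP[lab inc].
all: have [||F1 [ts [F2 FE]]] := min_label_is_root (x := x) inc;
  [by rewrite (perm_mem lab) mem_head
  |by apply/allP => y; rewrite (perm_mem lab) mem_iota => /andP[]|].
all: move: F_inc; rewrite FE increasing_forest_graft => F'_inc.
  (* No label but [x] remains, so [F1], [ts] and [F2] are empty. *)
  case/andP: F'_inc => /perm_size/=.
  case: F1 ts {FE} => [|[? ?] ?] [|[? ?] ?] //=.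
  by case: F2 => [|[? ?] ?] //= _ _; exists [::].
have [w [sw w_ok wE]] := IH _ _ F'_inc.
have [l lE] := outdegree_surj (size ts).
exists ((l, size F1) :: w); split => /=; first by rewrite sw.
  rewrite !size_cat /= addnS ltnS leq_addr /= lE.
  by move: w_ok; rewrite !size_cat addnA addnAC.
by rewrite wE lE take_size_cat // !drop_size_cat // take_size_cat.
Qed.

(** * Codes as path diagrams *)

Local Open Scope ring_scope.

(** Carrying the current height [y] replaces prefix sums by a recursion on the word. *)
Fixpoint labelled_path_from (y : int) (u : seq letter) : seq lletter :=
  if u is x :: u' then label y x :: labelled_path_from (y + (step x).2) u'
  else [::].

Fixpoint admissible_from (y : int) (u : seq letter) : bool :=
  (0 <= y) &&
  (if u is x :: u' then admissible_from (y + (step x).2) u' else y == 0).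

Lemma height0 (u : seq letter) : height u 0%N = 0.
Proof. by rewrite /height /Defs.point take0 big_nil. Qed.

Lemma height_cons (x : letter) (u : seq letter) (j : nat) :
  height (x :: u) j.+1 = (step x).2 + height u j.
Proof. by rewrite /height /Defs.point /= big_cons. Qed.

Lemma labelled_path_fromE (y : int) (u : seq letter) :
  mkseq (fun j => label (y + height u j) (nth LC u j)) (size u) =
  labelled_path_from y u.
Proof.
elim: u y => [|x u IH] y //=.
rewrite -IH /mkseq /= height0 addr0; congr cons.
rewrite (iotaDl 1 0) -map_comp; apply: eq_map => j /=.
by rewrite height_cons addrA.
Qed.

Lemma labelled_pathE (u : seq letter) :
  labelled_path u = labelled_path_from 0 u.
Proof.
by rewrite -labelled_path_fromE; apply: eq_mkseq => j; rewrite add0r.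
Qed.

Lemma admissible_fromP (y : int) (u : seq letter) :
  reflect ((forall j, (j <= size u)%N -> 0 <= y + height u j) /\
           y + height u (size u) = 0)
          (admissible_from y u).
Proof.
elim: u y => [|x u IH] y /=.
  apply: (iffP andP); rewrite height0 addr0.
    by case=> y0 /eqP yE; split=> // j; rewrite leqn0 => /eqP->; rewrite height0 addr0.
  by case=> /(_ 0%N isT); rewrite height0 addr0 => y0 ->.
rewrite height_cons addrA; apply: (iffP andP) => [[y0 /IH[pos ->]]|[pos yE]].
  split=> // -[|j] ju; first by rewrite height0 addr0.
  by rewrite height_cons addrA pos.
split; first by have := pos 0%N isT; rewrite height0 addr0.
by apply/IH; split=> // j ju; have := pos j.+1 ju; rewrite height_cons addrA.
Qed.

Lemma admissibleP (u : seq letter) :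
  reflect (admissible u) (admissible_from 0 u).
Proof.
apply: (iffP (admissible_fromP 0 u)); rewrite /admissible add0r.
  by case=> pos ->; split=> // j /pos; rewrite add0r.
by case=> pos ->; split=> // j /pos; rewrite add0r.
Qed.

(** With [k] open slots the height is [k - 1], so the possibility is [k], and a step adds the
    outdegree minus one. *)
Lemma validE (k : nat) (w : seq (letter * nat)) :
  valid k w =
    admissible_from (k%:Z - 1) (unzip1 w) &&
    all2 (fun v s => 0 <= s < port_pos v)
      (labelled_path_from (k%:Z - 1) (unzip1 w)) (map Posz (unzip2 w)).
Proof.
elim: w k => [|[x s] w IH] k /=; first by lia.
(* Without an open slot the height is -1 and both sides fail. *)
case: k => [|k]; first by rewrite ltn0.
have -> : k.+1%:Z - 1 = k%:Z by lia.
have -> : k%:Z + (step x).2 = (k + outdegree x)%N%:Z - 1.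
  by rewrite step2E; lia.
rewrite IH /= andbCA; congr andb.
have -> // : port_pos (label k x) = k.+1%:Z by case: x {IH} => /=; lia.
Qed.

Lemma labelled_path_from_inj (y : int) : injective (labelled_path_from y).
Proof.
move=> u; elim: u y => [|x u IH] y [|x' u'] //= [].
case: x x' => [l| |] [l'| |] //=; [case=> ->|move=> _|move=> _]; by move/IH->.
Qed.

Lemma size_labelled_path_from (y : int) (u : seq letter) :
  size (labelled_path_from y u) = size u.
Proof. by rewrite -labelled_path_fromE size_mkseq. Qed.

(** * The two bijections and their composition *)

Definition codes (n : nat) : set (seq (letter * nat)) :=
  [set w | size w = n /\ valid 1 w]%classic.

Lemma codes_trees_bij (n : nat) :
  set_bij (codes n) (plane_increasing_trees n.+1)
    (fun w => head (Node 0 [::]) (decode 1 w)).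
Proof.
(* One initial slot yields exactly one tree, so the default of [head] is never reached. *)
have decode1 w : valid 1 w ->
    decode 1 w = [:: head (Node 0 [::]) (decode 1 w)].
  by move/(size_decode 1); case: (decode 1 w) => [|t []].
have tree_forest t : plane_increasing_trees n.+1 t <->
    increasing_forest 1 n.+1 [:: t].
  by rewrite /plane_increasing_trees /increasing_forest /forest_labels /= cats0 andbT.
split.
- move=> w [sw w_ok]; apply/tree_forest; rewrite -decode1 // -sw.
  exact: decode_forest w_ok.
- move=> w w' /set_mem[sw w_ok] /set_mem[sw' w'_ok] eq_ww'.
  apply: (decode_inj w_ok w'_ok (x := 1)); first by rewrite sw sw'.
  by rewrite decode1 // [RHS]decode1 // eq_ww'.
- move=> t /tree_forest/decode_surj[w [sw w_ok wE]].
  by exists w; rewrite ?wE.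
Qed.

Lemma codes_diagrams_bij (n : nat) :
  set_bij (codes n) (path_diagrams port_pos n)
    (fun w => (labelled_path (unzip1 w), map Posz (unzip2 w))).
Proof.
split.
- move=> w [sw]; rewrite validE => /andP[/admissibleP w_adm w_pos].
  exists (unzip1 w); rewrite labelled_pathE size_map.
  by split.
- move=> w w' _ _ []; rewrite !labelled_pathE => /labelled_path_from_inj eq1.
  have Posz_inj : injective Posz by move=> a b [].
  move=> /(inj_map Posz_inj) eq2.
  by rewrite -(zip_unzip w) -(zip_unzip w') eq1 eq2.
- case=> vs ss [u [su /admissibleP u_adm /= -> u_pos]].
  (* The bound [0 <= s] makes [absz] lossless. *)
  have ssE : map Posz (map absz ss) = ss.
    elim: ss (labelled_path u) u_pos => [|s ss IH] [|v vs'] //=.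
    by case/andP=> /andP[s0 _] /IH->; congr cons; lia.
  move: u_pos; rewrite labelled_pathE => u_pos.
  have sz : size u = size (map absz ss).
    move: u_pos; rewrite all2E size_labelled_path_from size_map.
    by case/andP=> /eqP.
  exists (zip u (map absz ss)); rewrite ?unzip1_zip ?unzip2_zip ?sz //.
    split; first by rewrite size1_zip -?sz.
    by rewrite validE unzip1_zip ?unzip2_zip ?sz // ssE u_adm.
  by rewrite labelled_pathE ssE.
Qed.

(** The map is [h] after an inverse of [g] on [B] obtained by choice; the inhabitant of [T] is its
    value outside [B]. *)
Lemma set_bij_span (T U V : Type) (A : set T) (B : set U) (C : set V)
    (g : T -> U) (h : T -> V) :
  inhabited T -> set_bij A B g -> set_bij A C h -> exists f, set_bij B C f.
Proof.
case=> a0 [gfun ginj gsurj] [hfun hinj hsurj].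
have [g' g'P] : {g' : U -> T & forall b, B b -> A (g' b) /\ g (g' b) = b}.
  apply: (@choice _ _ (fun b a => B b -> A a /\ g a = b)) => b.
  have [/gsurj[a Aa ab]|nBb] := pselect (B b); first by exists a.
  by exists a0.
exists (h \o g'); split.
- by move=> b /g'P[/hfun].
- move=> b b' /set_mem/g'P[Ab bE] /set_mem/g'P[Ab' b'E] /= eq_h.
  by rewrite -bE -b'E (hinj _ _ (mem_set Ab) (mem_set Ab') eq_h).
- move=> c /hsurj[a Aa ac]; exists (g a); first exact: gfun.
  have [Aga gaE] := g'P _ (gfun _ Aa).
  by rewrite /= (ginj _ _ (mem_set Aga) (mem_set Aa) gaE).
Qed.

Close Scope ring_scope.

Theorem theorem6 (n : nat) :
  exists f : ltree -> seq lletter * seq int,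
    set_bij (plane_increasing_trees n.+1) (path_diagrams port_pos n) f.
Proof.
apply: (set_bij_span _ (codes_trees_bij n) (codes_diagrams_bij n)).
exact: (inhabits [::]).
Qed.
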